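(* Let $2\le k\le\omega$. For every $T\in\mathcal T_\omega(\bar k)$ we have $\Sigma(\mathbb N,T)=\{B\in k^\omega\mid B\le \mathbf f(T)\}$; i.e. $\mathbf f(T)$ belongs to $\Sigma(\mathbb N,T)$ and every element of $\Sigma(\mathbb N,T)$ is reducible to it.
   Context: Trees: $\bar k=\{i\in\omega:i<k\}$ (antichain). $\omega^*$ finite sequences, $\sqsubseteq$ prefix, $\varepsilon$ empty. A finite normal tree is a finite nonempty prefix-closed $T\subseteq\omega^*$ with $\tau(i+1)\in T\Rightarrow\tau i\in T$; $T(\tau)=\{\sigma:\tau\sigma\in T\}$ (with the inherited labelling). For a preorder $Q$, a $Q$-tree is $(T,t)$, $t:T\to Q$; h-preorder: $(T,t)\le_h(V,v)$ iff some $\sqsubseteq$-monotone $f:T\to V$ has $t(\tau)\le_Q v(f(\tau))$ for all $\tau$. $\mathcal T_0(\bar k)=\bar k$, $\mathcal T_{m+1}(\bar k)=$ the $\mathcal T_m(\bar k)$-trees. $\mathcal T_\omega(\bar k)=\bigsqcup_m\mathcal T_m(\bar k)$. Hierarchy: $\Sigma^0_{1+n}(\mathbb N)$ is the arithmetical class $\Sigma^0_{n+1}$. For $Y\subseteq\omega$ let $\mathcal L^n_j(Y)=\{Y\cap S:S\in\Sigma^0_{1+n+j}(\mathbb N)\}$. For $T\in\mathcal T_m(\bar k)$ a $T$-family in $\mathcal L^n(Y)$ and the $k$-partition it determines are defined inductively: for $T=i\in\bar k$ the family $\{Y\}$ determines the constant $i$; for $(T,t)\in\mathcal T_{m+1}(\bar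 k)$ it is $(\{U_\tau\},\{F_\tau\})_{\tau\in T}$ with $U_\tau\in\mathcal L^n_0(Y)$, $U_\varepsilon=Y$, $U_\tau\supseteq U_{\tau'}$ for $\tau\sqsubseteq\tau'$, $F_\tau$ a $t(\tau)$-family in $\mathcal L^{n+1}(\tilde U_\tau)$, $\tilde U_\tau=U_\tau\setminus\bigcup_{\tau\sqsubset\tau'\in T}U_{\tau'}$, determining $A$ with $A|_{\tilde U_\tau}$ the partition determined by $F_\tau$. $\Sigma(\mathbb N,T)$ = the $A:\omega\to\bar k$ determined by a $T$-family in $\mathcal L^0(\omega)$. Numberings: $k^\omega$ is the set of functions $\omega\to\bar k$. For $\mu,\nu\in k^\omega$, $\mu\le\nu$ iff $\mu=\nu\circ g$ for a total computable $g$. $\langle\cdot,\cdot\rangle$ is a computable pairing bijection. For $h\in\omega^\omega$, $\tilde\varkappa^h$ is the universal $h$-partial computable function, $\tilde\varkappa^h(\langle x,y\rangle)=\varkappa^h_x(y)$ with $\varkappa^h$ the Kleene numbering of $h$-partial computable functions. For $\mu,\nu\in k^\omega$, $h\in\omega^\omega$: $G(\mu,\nu,h)\langle n,x\rangle=\nu(n)$ if $\tilde\varkappa^h(x)$ is undefined and $=\mu(\tilde\varkappa^h(x))$ otherwise. Let $\mathbf 0^{(0)}=\lambda x.0$, $\mathbf 0^{(n+1)}=G(\lambda x.0,\lambda x.1,\mathbf 0^{(n)})$, and $\nu\cdot^n\mu=G(\mu,\nu,\mathbf 0^{(n)})$. For $\nu_0,\dots,\nu_{p-1}$ let $(\bigoplus_{i<p}\nu_i)(pa+i)=\nu_i(a)$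 for $i<p$. Define $\mathbf f^n_m:\mathcal T_m(\bar k)\to k^\omega$ by induction on $m$: $\mathbf f^n_0(i)=\lambda x.i$; for $(T,t)\in\mathcal T_{m+1}(\bar k)$: if $T=\{\varepsilon\}$ then $\mathbf f^n_{m+1}(T)=\mathbf f^{n+1}_m(t(\varepsilon))$, otherwise (by induction on rank of $T$) $\mathbf f^n_{m+1}(T)=\mathbf f^{n+1}_m(t(\varepsilon))\cdot^n\bigoplus\{\mathbf f^n_{m+1}(T(i)): i\in\omega\cap T\}$. Finally $\mathbf f(T)=\mathbf f^0_m(T)$ for the unique $m$ with $T\in\mathcal T_m(\bar k)$. *)

(* Defs.v *)
From Stdlib Require Cantor.
From mathcomp Require Import all_boot.
From mathcomp Require Import boolp classical_sets.

Set Implicit Arguments.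
Unset Strict Implicit.
Unset Printing Implicit Defensive.

Local Open Scope classical_set_scope.

Definition npair (x y : nat) : nat := Cantor.to_nat (x, y).
Definition nfst (z : nat) : nat := (Cantor.of_nat z).1.
Definition nsnd (z : nat) : nat := (Cantor.of_nat z).2.

(* Unary mu-recursive functions with an oracle; several arguments are passed
   through the computable bijection [npair]. *)
Inductive code : Type :=
| CZero | CSucc | CFst | CSnd | COracle
| CPair of code & code
| CComp of code & code
| CRec of code & code
| CMin of code.

Inductive eval (h : nat -> nat) : code -> nat -> nat -> Prop :=
| eval_zero n : eval h CZero n 0
| eval_succ n : eval h CSucc n n.+1
| eval_fst n : eval h CFst n (nfst n)
| eval_snd n : eval h CSnd n (nsnd n)
| eval_oracle n : eval h COracle n (h n)
| eval_pair c d n a b :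
    eval h c n a -> eval h d n b -> eval h (CPair c d) n (npair a b)
| eval_comp c d n a b :
    eval h d n a -> eval h c a b -> eval h (CComp c d) n b
| eval_rec0 c d a b : eval h c a b -> eval h (CRec c d) (npair a 0) b
| eval_recS c d a i r b :
    eval h (CRec c d) (npair a i) r -> eval h d (npair a (npair i r)) b ->
    eval h (CRec c d) (npair a i.+1) b
| eval_min c a i (r : nat -> nat) :
    (forall j, j < i -> eval h c (npair a j) (r j).+1) ->
    eval h c (npair a i) 0 -> eval h (CMin c) a i.

Fixpoint encode (c : code) : nat :=
  match c with
  | CZero => npair 0 0
  | CSucc => npair 1 0
  | CFst => npair 2 0
  | CSnd => npair 3 0
  | COracle => npair 4 0
  | CPair c d => npair 5 (npair (encode c) (encode d))
  | CComp c d => npair 6 (npair (encode c) (encode d))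
  | CRec c d => npair 7 (npair (encode c) (encode d))
  | CMin c => npair 8 (encode c)
  end.

(* Kleene numbering of the [h]-partial computable functions; numbers that code
   no program index the nowhere defined function. *)
Definition kleene_graph (h : nat -> nat) (x y v : nat) : Prop :=
  exists2 c, encode c = x & eval h c y v.

Definition kleene (h : nat -> nat) (x y : nat) : option nat :=
  match pselect (exists v, kleene_graph h x y v) with
  | left e => Some (projT1 (cid e))
  | right _ => None
  end.

Definition universal (h : nat -> nat) (z : nat) : option nat :=
  kleene h (nfst z) (nsnd z).

(* The oracle [fun=> 0] gives no information, so this is plain computability. *)
Definition computable (g : nat -> nat) : Prop :=
  exists x, forall y, kleene (fun=> 0) x y = Some (g y).

Definition decidable_set (S : set nat) : Prop :=
  exists2 g, computable g & forall x, S x <-> g x = 1.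

(* [Sigma0 n] is the arithmetical class with n alternating quantifiers, the
   outermost one being existential, in front of a computable relation. *)
Fixpoint Sigma0 (n : nat) : set (set nat) :=
  match n with
  | 0 => [set S | decidable_set S]
  | n.+1 => [set S | exists2 P, Sigma0 n P &
               forall x, S x <-> exists y, ~ P (npair x y)]
  end.

(* A finite normal tree [T] with labelling [t : T -> Q]; the children of a node
   are listed in order, and a node is addressed by the sequence of positions
   leading to it. See [nodes_normal] and [normal_tree_repr] below for the match
   with prefix-closed sets of sequences. *)
Inductive tree (Q : Type) : Type := Node of Q & seq (tree Q).

Definition root Q (T : tree Q) : Q := let: Node q _ := T in q.
Definition children Q (T : tree Q) : seq (tree Q) := let: Node _ ts := T in ts.

(* [subtree T tau] is T(tau), or [None] if tau is not in T. *)
Fixpoint subtree Q (T : tree Q) (tau : seq nat) : option (tree Q) :=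
  match tau with
  | [::] => Some T
  | i :: tau' =>
      if onth (children T) i is Some T' then subtree T' tau' else None
  end.

Definition label Q (T : tree Q) (tau : seq nat) : option Q :=
  omap (@root Q) (subtree T tau).

Definition in_tree Q (T : tree Q) (tau : seq nat) : bool :=
  isSome (subtree T tau).

(* The ordinals k <= omega: [Some n] is n and [None] is omega. *)
Definition below (k : option nat) : Type :=
  {i : nat | if k is Some n then i < n else true}.

Definition two_le (k : option nat) : bool :=
  if k is Some n then 2 <= n else true.

Fixpoint Tm (k : option nat) (m : nat) : Type :=
  match m with
  | 0 => below k
  | m.+1 => tree (Tm k m)
  end.

Definition Tomega (k : option nat) : Type := {m : nat & Tm k m}.

Definition Lset (n j : nat) (Y : set nat) : set (set nat) :=
  [set U | exists2 S, Sigma0 (1 + n + j) S & U = Y `&` S].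

(* Raw data of a family for a tree in [Tm k m]: a set if m = 0, otherwise the
   U_tau and the F_tau (whose values outside the tree are irrelevant). *)
Fixpoint family (m : nat) : Type :=
  match m with
  | 0 => set nat
  | m.+1 => ((seq nat -> set nat) * (seq nat -> family m))%type
  end.

Definition tilde Q (T : tree Q) (U : seq nat -> set nat) (tau : seq nat) :
    set nat :=
  U tau `\`
  \bigcup_(sg in [set sg | [&& in_tree T sg, prefix tau sg & tau != sg]]) U sg.

(* [is_family n Y T F]: F is a T-family in L^n(Y). *)
Fixpoint is_family (k : option nat) (m n : nat) (Y : set nat) :
    Tm k m -> family m -> Prop :=
  match m return Tm k m -> family m -> Prop with
  | 0 => fun _ F => F = Y
  | m.+1 => fun T UF =>
      let: (U, F) := UF in
      [/\ forall tau, in_tree T tau -> Lset n 0 Y (U tau),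
          U [::] = Y,
          forall tau sg, in_tree T tau -> in_tree T sg -> prefix tau sg ->
            U sg `<=` U tau
        & forall tau q, label T tau = Some q ->
            is_family n.+1 (tilde T U tau) q (F tau)]
  end.

(* [determines Y T F A]: the restriction of A to Y is the partition determined
   by the T-family F over Y. *)
Fixpoint determines (k : option nat) (m : nat) (Y : set nat) :
    Tm k m -> family m -> (nat -> below k) -> Prop :=
  match m return Tm k m -> family m -> (nat -> below k) -> Prop with
  | 0 => fun i _ A => forall x, Y x -> A x = i
  | m.+1 => fun T UF A =>
      let: (U, F) := UF in
      forall tau q, label T tau = Some q ->
        determines (tilde T U tau) q (F tau) A
  end.

Definition SigmaN (k : option nat) (T : Tomega k) : set (nat -> below k) :=
  [set A | exists2 F, is_family 0 [set: nat] (tagged T) F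
                    & determines [set: nat] (tagged T) F A].

Definition reducible Q (mu nu : nat -> Q) : Prop :=
  exists2 g, computable g & mu = nu \o g.

Definition Gop Q (mu nu : nat -> Q) (h : nat -> nat) : nat -> Q := fun z =>
  if universal h (nsnd z) is Some v then mu v else nu (nfst z).

Fixpoint zero_jump (n : nat) : nat -> nat :=
  match n with
  | 0 => fun=> 0
  | n.+1 => Gop (fun=> 0) (fun=> 1) (zero_jump n)
  end.

Definition cdot Q (n : nat) (nu mu : nat -> Q) : nat -> Q :=
  Gop mu nu (zero_jump n).

(* The join of the nonempty list [nu0 :: nus]. *)
Definition oplus Q (nu0 : nat -> Q) (nus : seq (nat -> Q)) : nat -> Q :=
  let s := nu0 :: nus in
  fun x => nth nu0 s (x %% size s) (x %/ size s).

Fixpoint fnm (k : option nat) (m n : nat) : Tm k m -> nat -> below k :=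
  match m return Tm k m -> nat -> below k with
  | 0 => fun i => fun=> i
  | m.+1 => fix fT (T : tree (Tm k m)) : nat -> below k :=
      let: Node q ts := T in
      if ts is t0 :: ts'
      then cdot n (@fnm k m n.+1 q) (oplus (fT t0) (map fT ts'))
      else @fnm k m n.+1 q
  end.

Definition fomega (k : option nat) (T : Tomega k) : nat -> below k :=
  fnm 0 (tagged T).

Lemma npair_inj a b c d : (npair a b) = (npair c d) -> a = c /\ b = d.
Proof.
move=> e; have : Cantor.of_nat (npair a b) = Cantor.of_nat (npair c d) by rewrite e.
by rewrite !Cantor.cancel_of_to; case.
Qed.

Lemma encode_inj : injective encode.
Proof.
elim=> [|||||c IHc d IHd|c IHc d IHd|c IHc d IHd|c IHc];
  case=> [|||||c' d'|c' d'|c' d'|c'] // /npair_inj[] // _;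
  by [move=> /npair_inj[/IHc-> /IHd->] | move=> /IHc->].
Qed.

Lemma eval_fun h c x v w : eval h c x v -> eval h c x w -> v = w.
Proof.
move=> H; elim: H w => {c x v}.
- by move=> n w H; inversion H.
- by move=> n w H; inversion H.
- by move=> n w H; inversion H.
- by move=> n w H; inversion H.
- by move=> n w H; inversion H.
- move=> c d n a b _ IHa _ IHb w H; inversion H as [| | | | |? ? ? a' b' Ha Hb| | | |].
  by rewrite (IHa _ Ha) (IHb _ Hb).
- move=> c d n a b _ IHa _ IHb w H; inversion H as [| | | | | |? ? ? a' b' Ha Hb| | |].
  by subst; move: Hb; rewrite -(IHa _ Ha) => /IHb.
- move=> c d a b _ IH w; move Ez: (npair a 0) => z H.
  inversion H as [| | | | | | |? ? a' b' Hb E e1 e2|? ? a' i r b' Hr Hb E e1 e2|];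
    case/npair_inj: (etrans Ez (esym e1)) => // ? _; subst; exact: IH.
- move=> c d a i r b _ IHr _ IHb w; move Ez: (npair a i.+1) => z H.
  inversion H as [| | | | | | |? ? a' b' Hb E e1 e2|? ? a' i' r' b' Hr Hb E e1 e2|];
    case/npair_inj: (etrans Ez (esym e1)) => // ? [?]; subst.
  by move: Hb; rewrite -(IHr _ Hr) => /IHb.
- move=> c a i r _ IHr _ IH0 w H.
  inversion H as [| | | | | | | | |? ? i' r' Hr H0 E e1 e2]; subst.
  case: (ltngtP i w) => // lt.
    by have := IH0 _ (Hr _ lt).
  by have := IHr _ lt _ H0.
Qed.

Lemma kleeneP h x y v : kleene h x y = Some v <-> kleene_graph h x y v.
Proof.
rewrite /kleene; case: pselect => [e|ne]; last first.
  by split=> // H; case: ne; exists v.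
case: (cid e) => w /= Hw; split=> [[<-]//|Hv]; congr Some.
case: Hw Hv => c <- Hw [d /encode_inj -> Hv]; exact: eval_fun Hw Hv.
Qed.

Definition normal_tree (D : seq (seq nat)) : Prop :=
  [/\ [::] \in D,
      forall tau sg, prefix tau sg -> sg \in D -> tau \in D
    & forall tau i, rcons tau i.+1 \in D -> rcons tau i \in D].

Fixpoint nodes Q (T : tree Q) : seq (seq nat) :=
  let: Node _ ts := T in
  let ss := map (@nodes Q) ts in
  [::] :: flatten [seq map (cons i) (nth [::] ss i) | i <- iota 0 (size ts)].

Lemma onth_lt S (x0 : S) s i : i < size s -> onth s i = Some (nth x0 s i).
Proof. by move=> lt; rewrite onthE (nth_map x0). Qed.

Lemma mem_nodes Q (T : tree Q) tau : (tau \in nodes T) = in_tree T tau.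
Proof.
elim: tau T => [|i tau IH] [q ts] //.
rewrite /= inE /= /in_tree /=; apply/flatten_mapP/idP => [[j]|].
  rewrite mem_iota add0n /= => jp /mapP[s + [-> e]]; rewrite -e (nth_map (Node q ts)) //.
  by rewrite IH (onth_lt (Node q ts)).
case: ltnP (@onth_default _ i ts) => [ip _|_ -> //].
rewrite (onth_lt (Node q ts)) // => H; exists i; first by rewrite mem_iota.
by rewrite (nth_map (Node q ts)) // map_f // IH.
Qed.

Lemma subtree_cat Q (T : tree Q) tau sg :
  subtree T (tau ++ sg) = obind (fun T' => subtree T' sg) (subtree T tau).
Proof. by elim: tau T => //= i tau IH T; case: onth. Qed.

Lemma nodes_normal Q (T : tree Q) : normal_tree (nodes T).
Proof.
split=> [|tau sg /prefixP[s ->]|tau i]; rewrite !mem_nodes //.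
  by rewrite /in_tree subtree_cat; case: subtree.
rewrite /in_tree -!cats1 !subtree_cat; case: subtree => //= T'.
have E j : isSome (if onth (children T') j is Some T1 then Some T1 else None) =
    (j < size (children T')) by rewrite -onthTE; case: onth.
by have := E i.+1; rewrite /= => ->; rewrite E => /ltnW.
Qed.

Lemma normal_tree_repr Q (D : seq (seq nat)) (t : seq nat -> Q) :
  normal_tree D ->
  exists T : tree Q,
    forall tau, label T tau = if tau \in D then Some (t tau) else None.
Proof.
move=> [D0 Dp Dn].
pose build K := fix build n (P : pred (seq nat)) (u : seq nat -> Q) : tree Q :=
  if n is n'.+1 then
    Node (u [::]) [seq build n' (P \o cons i) (u \o cons i)
                  | i <- iota 0 (find (fun i => ~~ P [:: i]) (iota 0 K))]
  else Node (u [::]) [::].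
suff H : forall K n (P : pred (seq nat)) (u : seq nat -> Q),
   P [::] -> (forall tau sg, prefix tau sg -> P sg -> P tau) ->
   (forall tau i, P (rcons tau i.+1) -> P (rcons tau i)) ->
   (forall tau, P tau -> size tau < n) ->
   (forall tau, P tau -> all (fun i => i < K) tau) ->
   forall tau, label (build K n P u) tau = if P tau then Some (u tau) else None.
  exists (build (\max_(s <- D) \max_(i <- s) i).+1
    (\max_(s <- D) size s).+1 (mem D) t); apply: H => //.
    by move=> tau inD; rewrite ltnS; apply: leq_bigmax_seq.
  move=> tau inD; apply/allP => i itau; rewrite ltnS.
  by apply: leq_trans (leq_bigmax_seq _ inD isT); apply: leq_bigmax_seq.
move=> K; elim=> [|n IH] P u P0 Pp Pn Psz PK; first by have := Psz _ P0.
case=> [|i tau]; first by rewrite /= P0.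
rewrite /label /=.
set p := find _ _.
have Pdown j l : j <= l -> P [:: l] -> P [:: j].
  move=> /subnKC <-; elim: (l - j) => [|d IHd]; first by rewrite addn0.
  by rewrite addnS => /(Pn [::]) /IHd.
have pP j : P [:: j] = (j < p).
  case: (ltnP j p) => [jp|pj].
    have jK : j < K.
      by apply: leq_trans jp _; rewrite -[leqRHS](size_iota 0); apply: find_size.
    have := before_find 0 jp; rewrite nth_iota // add0n.
    by move/negbFE.
  apply/negP => Pj; have jK : j < K by have := PK _ Pj => /=; rewrite andbT.
  have pK : p < K by apply: leq_ltn_trans pj jK.
  have hp : has (fun i => ~~ P [:: i]) (iota 0 K).
    by rewrite has_find size_iota.
  have := nth_find 0 hp; rewrite -/p nth_iota // add0n.
  by rewrite (Pdown _ _ pj Pj).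
have onthE : onth [seq build K n (P \o cons i) (u \o cons i) | i <- iota 0 p] i =
    if i < p then Some (build K n (P \o cons i) (u \o cons i)) else None.
  rewrite onth_map; case: ltnP => ip.
    by rewrite (onth_lt 0) ?size_iota // nth_iota // add0n.
  by rewrite onth_default // size_iota.
rewrite onthE; case: ifP => ip; last first.
  case: ifP => // Pi; suff : P [:: i] by rewrite pP ip.
  by apply: Pp Pi; rewrite /= eqxx prefix0s.
have {}IH := IH (P \o cons i) (u \o cons i); rewrite /label in IH.
rewrite IH //=.
- by rewrite pP ip.
- by move=> s1 s2 s12 /=; apply: Pp; rewrite /= eqxx.
- by move=> s j /=; rewrite -!rcons_cons; apply: Pn.
- by move=> s /= /Psz.
- by move=> s /= /PK /= /andP[].
Qed.

(* Main.v *)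
(** Two facts link the numberings to the hierarchy. The graph of the n-th jump
    [zero_jump n], hence of its universal partial function, is Sigma_(n+1); and
    every Sigma_(n+1) relation R has a selector, a partial function computable
    in [zero_jump n] that finds some v with R x v whenever there is one.

    A family for a node with children T_0, ..., T_(p-1) amounts to Sigma_(n+1)
    subsets U_i of Y carrying families for the T_i, and to a family one level
    higher for the root label on the rest of Y. Given a family, a selector that
    finds for x a child i with x in U_i and the value at x of the reduction for
    T_i provides the argument of [cdot]. Conversely, for a reduction of A to [fnm n T], let U_i
    be the set of x on which the computation made by [cdot] halts with a value
    congruent to i modulo p. *)
Require Import Defs.
From mathcomp Require Import all_boot.
From mathcomp Require Import boolp classical_sets.
From Stdlib Require Cantor.

Local Open Scope classical_set_scope.

Set Implicit Arguments.
Unset Strict Implicit.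

Arguments npair : simpl never.
Arguments nfst : simpl never.
Arguments nsnd : simpl never.

(** * Total functions computable in an oracle *)

Lemma npairK x y : nfst (npair x y) = x.
Proof. by rewrite /nfst Cantor.cancel_of_to. Qed.

Lemma npairKr x y : nsnd (npair x y) = y.
Proof. by rewrite /nsnd Cantor.cancel_of_to. Qed.

Lemma npair_eta z : npair (nfst z) (nsnd z) = z.
Proof. by rewrite /npair -surjective_pairing Cantor.cancel_to_of. Qed.

Definition npairE := (npairK, npairKr, npair_eta).

Definition Comp (h f : nat -> nat) : Prop := exists c, forall x, eval h c x (f x).

Section Comp.
Variable h : nat -> nat.
Implicit Types f g b : nat -> nat.

Lemma Comp_id : Comp h (fun x => x).
Proof.
exists (CPair CFst CSnd) => x; rewrite -{2}(npair_eta x).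
by apply: eval_pair; constructor.
Qed.

Lemma Comp_const n : Comp h (fun=> n).
Proof.
elim: n => [|n [c Hc]]; first by exists CZero; constructor.
by exists (CComp CSucc c) => x; apply: eval_comp (Hc x) _; constructor.
Qed.

Lemma Comp_comp f g : Comp h f -> Comp h g -> Comp h (fun x => f (g x)).
Proof. by move=> [c Hc] [d Hd]; exists (CComp c d) => x; apply: eval_comp. Qed.

Lemma Comp_succ f : Comp h f -> Comp h (fun x => (f x).+1).
Proof. by apply: Comp_comp; exists CSucc; constructor. Qed.

Lemma Comp_fst f : Comp h f -> Comp h (fun x => nfst (f x)).
Proof. by apply: Comp_comp; exists CFst; constructor. Qed.

Lemma Comp_snd f : Comp h f -> Comp h (fun x => nsnd (f x)).
Proof. by apply: Comp_comp; exists CSnd; constructor. Qed.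

Lemma Comp_oracle f : Comp h f -> Comp h (fun x => h (f x)).
Proof. by apply: Comp_comp; exists COracle; constructor. Qed.

Lemma Comp_pair f g : Comp h f -> Comp h g -> Comp h (fun x => npair (f x) (g x)).
Proof. by move=> [c Hc] [d Hd]; exists (CPair c d) => x; apply: eval_pair. Qed.

(** [CRec] hands its step code the parameter, the counter and the previous value packed as
    [npair a (npair i r)], whence the shape of the hypothesis on [g]. The arithmetic below is built
    from such loops. *)
Lemma Comp_iteri b (g : nat -> nat -> nat -> nat) f :
  Comp h b -> Comp h (fun w => g (nfst w) (nfst (nsnd w)) (nsnd (nsnd w))) ->
  Comp h f -> Comp h (fun x => iteri (b x) (g x) (f x)).
Proof.
move=> Hb [d Hd] [c Hc].
suff /Comp_comp /(_ (Comp_pair Comp_id Hb)) [e He] :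
    Comp h (fun w => iteri (nsnd w) (g (nfst w)) (f (nfst w))).
  by exists e => x; have := He x; rewrite !npairE.
exists (CRec c d) => w; rewrite -{1}(npair_eta w).
elim: (nsnd w) => [|i IH] /=; first exact: eval_rec0.
by apply: eval_recS IH _; have := Hd (npair (nfst w) (npair i
  (iteri i (g (nfst w)) (f (nfst w))))); rewrite !npairE.
Qed.

Lemma Comp_pred f : Comp h f -> Comp h (fun x => (f x).-1).
Proof.
move=> Hf; have -> : (fun x => (f x).-1) = (fun x => iteri (f x) (fun i _ => i) 0).
  by apply/funext => x; case: (f x).
by apply: (Comp_iteri (g := fun _ i _ => i)) => //;
  [apply/Comp_fst/Comp_snd/Comp_id | apply: Comp_const].
Qed.

Lemma Comp_add f g : Comp h f -> Comp h g -> Comp h (fun x => f x + g x).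
Proof.
move=> Hf Hg; have -> : (fun x => f x + g x) =
    (fun x => iteri (f x) (fun _ r => r.+1) (g x)).
  by apply/funext => x; elim: (f x) => //= i <-.
by apply: (Comp_iteri (g := fun _ _ r => r.+1)) => //;
  apply/Comp_succ/Comp_snd/Comp_snd/Comp_id.
Qed.

Lemma Comp_mul f g : Comp h f -> Comp h g -> Comp h (fun x => f x * g x).
Proof.
move=> Hf Hg; have -> : (fun x => f x * g x) =
    (fun x => iteri (f x) (fun _ r => g x + r) 0).
  by apply/funext => x; elim: (f x) => //= i <-; rewrite mulSn.
apply: (Comp_iteri (g := fun x _ r => g x + r)) => //; last exact: Comp_const.
apply: Comp_add; last exact/Comp_snd/Comp_snd/Comp_id.
by apply: Comp_comp Hg _; apply/Comp_fst/Comp_id.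
Qed.

Lemma Comp_sub f g : Comp h f -> Comp h g -> Comp h (fun x => f x - g x).
Proof.
move=> Hf Hg; have -> : (fun x => f x - g x) =
    (fun x => iteri (g x) (fun _ r => r.-1) (f x)).
  by apply/funext => x; elim: (g x) => [|i /= <-]; rewrite ?subn0 ?subnS.
by apply: (Comp_iteri (g := fun _ _ r => r.-1)) => //;
  apply/Comp_pred/Comp_snd/Comp_snd/Comp_id.
Qed.

Lemma Comp_leq f g : Comp h f -> Comp h g -> Comp h (fun x => (f x <= g x : nat)).
Proof.
move=> Hf Hg; have -> : (fun x => f x <= g x : nat) = (fun x => 1 - (f x - g x)).
  by apply/funext => x; rewrite /leq; case: (_ - _).
by apply: Comp_sub; [apply: Comp_const | apply: Comp_sub].
Qed.

Lemma Comp_eqn f g : Comp h f -> Comp h g -> Comp h (fun x => (f x == g x : nat)).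
Proof.
move=> Hf Hg; have -> : (fun x => f x == g x : nat) =
    (fun x => (f x <= g x : nat) * (g x <= f x : nat)).
  by apply/funext => x; rewrite mulnb -eqn_leq.
by apply: Comp_mul; apply: Comp_leq.
Qed.

(** A loop run once or not at all: the test itself is the number of rounds. *)
Lemma Comp_if (d : pred nat) f g : Comp h (fun x => d x : nat) ->
  Comp h f -> Comp h g -> Comp h (fun x => if d x then f x else g x).
Proof.
move=> Hd Hf Hg; have -> : (fun x => if d x then f x else g x) =
    (fun x => iteri (d x) (fun _ _ => f x) (g x)).
  by apply/funext => x; case: (d x).
apply: (Comp_iteri (g := fun x _ _ => f x)) => //.
by apply: Comp_comp Hf _; apply/Comp_fst/Comp_id.
Qed.

End Comp.

(* Sequences are coded as iterated pairs without a length, so every number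
   codes an infinite sequence. *)
Definition pnth (L i : nat) : nat := nfst (iter i nsnd L).

(** Merges finitely many witnesses into one number, so that a quantifier over finite sequences
    becomes a single number quantifier. *)
Lemma pnth_surj (s : nat -> nat) n : exists L, forall i, i < n -> pnth L i = s i.
Proof.
elim: n s => [|n IH] s; first by exists 0.
have [L HL] := IH (s \o S); exists (npair (s 0) L) => -[|i] Hi.
  by rewrite /pnth npairE.
by rewrite /pnth iterSr npairE; apply: HL.
Qed.

Lemma Comp_pnth h f g : Comp h f -> Comp h g -> Comp h (fun x => pnth (f x) (g x)).
Proof.
move=> Hf Hg; apply: Comp_fst.
have -> : (fun x => iter (g x) nsnd (f x)) =
    (fun x => iteri (g x) (fun _ r => nsnd r) (f x)).
  by apply/funext => x; elim: (g x) => //= i ->.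
by apply: (Comp_iteri (g := fun _ _ r => nsnd r)) => //;
  apply/Comp_snd/Comp_snd/Comp_snd/Comp_id.
Qed.

Ltac comp := solve [repeat match goal with
  | H : Comp ?h ?g |- Comp ?h ?g => exact: H
  | |- Comp _ nfst => apply: (Comp_fst (Comp_id _))
  | |- Comp _ nsnd => apply: (Comp_snd (Comp_id _))
  | |- Comp _ (npair ?a) => apply: (Comp_pair (Comp_const _ a) (Comp_id _))
  | |- Comp _ (fun x => x) => apply: Comp_id
  | |- Comp _ (fun _ => ?n) => apply: Comp_const
  | H : Comp ?h ?g |- Comp ?h (fun x => ?g (@?f x)) => apply: (Comp_comp (g := f) H)
  | H : Comp ?h (fun y => nat_of_bool (?g y))
      |- Comp ?h (fun x => nat_of_bool (?g (@?f x))) => apply: (Comp_comp (g := f) H)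
  | |- Comp _ (fun x => npair (@?f x) (@?g x)) => apply: Comp_pair
  | |- Comp _ (fun x => pnth (@?f x) (@?g x)) => apply: Comp_pnth
  | |- Comp _ (fun x => nfst (@?f x)) => apply: Comp_fst
  | |- Comp _ (fun x => nsnd (@?f x)) => apply: Comp_snd
  | |- Comp _ (fun x => (@?f x).+1) => apply: Comp_succ
  | |- Comp _ (fun x => @?f x + @?g x) => apply: Comp_add
  | |- Comp _ (fun x => @?f x * @?g x) => apply: Comp_mul
  | |- Comp _ (fun x => nat_of_bool (@?f x <= @?g x)) => apply: Comp_leq
  | |- Comp _ (fun x => nat_of_bool (@?f x == @?g x)) => apply: Comp_eqn
  end].

(** * Decidable sets and closure properties of the arithmetical classes *)

Lemma computableE g : computable g <-> Comp (fun=> 0) g.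
Proof.
split=> [[x Hx]|[c Hc]]; last first.
  by exists (encode c) => y; apply/kleeneP; exists c.
(* The input 0 only serves to extract a program with index [x]; by injectivity of [encode] it is the
   program for every input. *)
have /kleeneP[c ec _] := Hx 0; exists c => y.
by have /kleeneP[d] := Hx y; rewrite -ec => /encode_inj ->.
Qed.

Lemma decidable_setE (S : set nat) : decidable_set S <->
  exists2 p : pred nat, Comp (fun=> 0) (fun x => p x : nat) & forall x, S x <-> p x.
Proof.
split=> [[g /computableE Hg HS]|[p Hp HS]]; last first.
  exists (fun x => p x : nat); first exact/computableE.
  by move=> x; rewrite HS; case: (p x).
exists (fun x => g x == 1); first by comp.
by move=> x; rewrite HS; split => /eqP.
Qed.

Section SigmaClosure.
Implicit Types (P Q : set nat) (d : pred nat) (f b : nat -> nat).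

Notation Cmp := (Comp (fun=> 0)).

Lemma Sigma0_iff n P Q : (forall x, P x <-> Q x) -> Sigma0 n P -> Sigma0 n Q.
Proof. by move=> e; have -> // : P = Q; apply/funext => x; apply/propext. Qed.

Lemma Sigma0_sub n P f : Cmp f -> Sigma0 n P -> Sigma0 n (fun x => P (f x)).
Proof.
elim: n P f => [|n IH] P f Hf /=.
  move/decidable_setE => [p Hp HP]; apply/decidable_setE.
  by exists (fun x => p (f x)) => //; comp.
move=> [Q HQ HP]; exists (fun w => Q (npair (f (nfst w)) (nsnd w))).
  by apply: (IH Q (fun w => npair (f (nfst w)) (nsnd w))) => //; comp.
move=> x; rewrite HP; split=> -[y Hy]; exists y; move: Hy; by rewrite !npairE.
Qed.

Lemma Sigma0_dec_compl n P : Sigma0 n P -> Sigma0 n.+1 (fun x => ~ P x).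
Proof.
move=> HP; exists (fun w => P (nfst w)); first by apply: Sigma0_sub HP; comp.
move=> x; split=> [Hx|[y]]; last by rewrite npairE.
by exists 0; rewrite npairE.
Qed.

(** Decidable sets are closed under complement, so a double complement settles the bottom level;
    above it, the induction raises the matrix under the quantifier. *)
Lemma Sigma0S n P : Sigma0 n P -> Sigma0 n.+1 P.
Proof.
elim: n P => [|n IH] P.
  move/decidable_setE => [p Hp HP].
  have : Sigma0 0 (fun x => ~ P x).
    apply/decidable_setE; exists (fun x => ~~ p x); last first.
      by move=> x; rewrite HP; split => /negP.
    have -> : (fun x => ~~ p x : nat) = (fun x => (p x : nat) == 0 : nat).
      by apply/funext => x; case: (p x).
    by comp.
  by move/Sigma0_dec_compl; apply: Sigma0_iff => x; split=> [/contrapT|Px /(_ Px)].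
by move=> [Q HQ HP]; exists Q => //; apply: IH.
Qed.

Lemma Sigma0_dec n d : Cmp (fun x => d x : nat) -> Sigma0 n (fun x => d x).
Proof.
move=> Hd; elim: n => [|n /Sigma0S//]; apply/decidable_setE.
by exists d.
Qed.

(** The test does not see the quantified variable, so the case distinction passes through the
    quantifiers and negations down to decidable sets. *)
Lemma Sigma0_if n d P Q : Cmp (fun x => d x : nat) -> Sigma0 n P -> Sigma0 n Q ->
  Sigma0 n (fun x => if d x then P x else Q x).
Proof.
elim: n d P Q => [|n IH] d P Q Hd.
  move=> /decidable_setE[p Hp HP] /decidable_setE[q Hq HQ]; apply/decidable_setE.
  exists (fun x => if d x then p x else q x); last first.
    by move=> x; case: (d x).
  have -> : (fun x => nat_of_bool (if d x then p x else q x)) =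
     (fun x => if d x then p x : nat else q x : nat).
    by apply/funext => x; case: (d x).
  exact: Comp_if.
move=> [P' HP' HP] [Q' HQ' HQ].
exists (fun w => if d (nfst w) then P' w else Q' w); first by apply: IH => //; comp.
move=> x; case E : (d x); rewrite ?HP ?HQ; split=> -[y Hy]; exists y; move: Hy;
  by rewrite npairE E.
Qed.

(** Each level of [Sigma0] negates its matrix, so the universal case at level [n.+1] needs the
    existential case at level [n]; hence one induction for both. *)
Lemma Sigma0_bounded n (R : nat -> nat -> Prop) b : Cmp b ->
  Sigma0 n (fun w => R (nfst w) (nsnd w)) ->
  Sigma0 n (fun x => forall i, i < b x -> R x i) /\
  Sigma0 n (fun x => exists2 i, i < b x & R x i).
Proof.
elim: n R b => [|n IH] R b Hb.
  move/decidable_setE => [p Hp HP].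
  (* The loop counts the [i < b x] that satisfy [q]; both bounded quantifiers are tests on such a
     count. *)
  have E (q : pred nat) x : (0 < iteri (b x) (fun i r => q (npair x i) + r) 0) <->
      (exists2 i, i < b x & q (npair x i)).
    elim: (b x) => [|i IHi] /=; first by split=> // -[].
    rewrite addn_gt0 lt0b; split=> [/orP[Hq|/IHi[j ji Hq]]|[j]].
    - by exists i.
    - by exists j => //; apply: ltnW.
    - rewrite ltnS leq_eqVlt => /orP[/eqP->->//|ji Hq].
      by apply/orP; right; apply/IHi; exists j.
  have C (q : pred nat) : Cmp (fun x => q x : nat) ->
      Cmp (fun x => iteri (b x) (fun i r => q (npair x i) + r) 0).
    move=> Hq; apply: (Comp_iteri (g := fun x i r => q (npair x i) + r)) => //; comp.
  split; apply/decidable_setE.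
    exists (fun x => iteri (b x) (fun i r => ~~ p (npair x i) + r) 0 == 0).
      have /C {}Hp : Cmp (fun x => ~~ p x : nat).
        have -> : (fun x => ~~ p x : nat) = (fun x => (p x : nat) == 0 : nat).
          by apply/funext => x; case: (p x).
        by comp.
      by comp.
    move=> x; have {}E := E (predC p) x.
    rewrite -[_ == 0]negbK -lt0n; split=> [HR|/negP HE i ib].
      by apply/negP => /E[i ib /negP]; apply; apply/HP; rewrite !npairE; apply: HR.
    have := HP (npair x i); rewrite !npairE => ->; apply: contrapT => np.
    by apply: HE; apply/E; exists i => //; apply/negP.
  exists (fun x => 0 < iteri (b x) (fun i r => p (npair x i) + r) 0).
    by have {}Hp := C _ Hp; comp.
  move=> x; rewrite E; split=> -[i ib H]; exists i => //.
    by apply/HP; rewrite !npairE.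
  by have := HP (npair x i); rewrite !npairE => ->.
move=> [Q HQ HR].
have {}HR x i : R x i <-> exists y, ~ Q (npair (npair x i) y).
  by rewrite -HR !npairE.
split.
  (* [nsnd w] codes a list of witnesses, one for each [i]; the matrix says that one of them
     fails. *)
  exists (fun w => exists2 i, i < b (nfst w) &
     Q (npair (npair (nfst w) i) (pnth (nsnd w) i))).
    apply: (IH (fun w i => Q (npair (npair (nfst w) i) (pnth (nsnd w) i)))
      (fun w => b (nfst w)) _ _).2; first by comp.
    apply: (Sigma0_sub (f := fun w => npair (npair (nfst (nfst w)) (nsnd w))
      (pnth (nsnd (nfst w)) (nsnd w))) _ HQ).
    by comp.
  move=> x; split=> [H|[L]]; last first.
    rewrite !npairE => HL i ib; apply/HR; exists (pnth L i) => q.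
    by apply: HL; exists i.
  have /choice[s Hs] : forall i, exists y, i < b x -> ~ Q (npair (npair x i) y).
    move=> i; case: (ltnP i (b x)) => [ib|_]; last by exists 0.
    by have /HR[y Hy] := H _ ib; exists y.
  have [L HL] := pnth_surj s (b x).
  by exists L; rewrite !npairE => -[i ib]; rewrite HL //; apply: Hs.
(* The witness is [i] paired with [y]. For [i] out of bounds the matrix is [True], so that its
   negation rejects the pair. *)
exists (fun w => if nfst (nsnd w) < b (nfst w) then
    Q (npair (npair (nfst w) (nfst (nsnd w))) (nsnd (nsnd w))) else True).
  apply: Sigma0_if; first by comp.
    apply: (Sigma0_sub (f := fun w => npair (npair (nfst w) (nfst (nsnd w)))
       (nsnd (nsnd w))) _ HQ); comp.
  by apply: (@Sigma0_iff _ (fun=> true)) => //; apply: Sigma0_dec; comp.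
move=> x; split=> [[i ib /HR[y Hy]]|[t]].
  by exists (npair i y); rewrite !npairE ib.
rewrite !npairE; case: ifP => // ib Hy; exists (nfst t) => //.
by apply/HR; exists (nsnd t).
Qed.

Lemma Sigma0_all n (R : nat -> nat -> Prop) b : Cmp b ->
  Sigma0 n (fun w => R (nfst w) (nsnd w)) ->
  Sigma0 n (fun x => forall i, i < b x -> R x i).
Proof. by move=> Hb HR; have [] := Sigma0_bounded Hb HR. Qed.

(** A bounded quantifier over [i < 2], with a decidable test choosing the set, yields the connective
    without a new induction. Disjunction is obtained in the same way. *)
Lemma Sigma0_and n P Q : Sigma0 n P -> Sigma0 n Q -> Sigma0 n (fun x => P x /\ Q x).
Proof.
move=> HP HQ; pose R x i := if i == 0 then P x else Q x.
have : Sigma0 n (fun x => forall i, i < 2 -> R x i).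
  apply: Sigma0_all; first by comp.
  apply: Sigma0_if; first by comp.
    by apply: Sigma0_sub HP; comp.
  by apply: Sigma0_sub HQ; comp.
apply: Sigma0_iff => x; split=> [H|[Px Qx] [|[]]//].
by split; [apply: (H 0) | apply: (H 1)].
Qed.

Lemma Sigma0_or n P Q : Sigma0 n P -> Sigma0 n Q -> Sigma0 n (fun x => P x \/ Q x).
Proof.
move=> HP HQ; pose R x i := if i == 0 then P x else Q x.
have : Sigma0 n (fun x => exists2 i, i < 2 & R x i).
  apply: (Sigma0_bounded (b := fun=> 2) _ _).2; first by comp.
  apply: Sigma0_if; first by comp.
    by apply: Sigma0_sub HP; comp.
  by apply: Sigma0_sub HQ; comp.
apply: Sigma0_iff => x; split=> [[[|i] _]|[]]; try by [left|right].
- by exists 0.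
- by exists 1.
Qed.

Lemma Sigma0_ex n (R : nat -> nat -> Prop) :
  Sigma0 n.+1 (fun w => R (nfst w) (nsnd w)) ->
  Sigma0 n.+1 (fun x => exists y, R x y).
Proof.
move=> [Q HQ HR].
exists (fun w => Q (npair (npair (nfst w) (nfst (nsnd w))) (nsnd (nsnd w)))).
  apply: (Sigma0_sub (f := fun w => npair (npair (nfst w) (nfst (nsnd w)))
       (nsnd (nsnd w))) _ HQ); comp.
move=> x; split=> [[y]|[t]].
  have := HR (npair x y); rewrite !npairE => -> [z Hz].
  by exists (npair y z); rewrite !npairE.
rewrite !npairE => Hz; exists (nfst t).
by have := HR (npair x (nfst t)); rewrite !npairE => ->; exists (nsnd t).
Qed.

Lemma Sigma0_eq n f g : Cmp f -> Cmp g -> Sigma0 n (fun x => f x = g x).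
Proof.
move=> Hf Hg; apply: (@Sigma0_iff _ (fun x => f x == g x)).
  by move=> x; split=> /eqP.
by apply: Sigma0_dec; comp.
Qed.

Lemma Sigma0_leq n f g : Cmp f -> Cmp g -> Sigma0 n (fun x => f x <= g x).
Proof. by move=> Hf Hg; apply: Sigma0_dec; comp. Qed.

End SigmaClosure.

Lemma Sigma0_sub2 n (R : nat -> nat -> Prop) f g :
  Sigma0 n (fun w => R (nfst w) (nsnd w)) ->
  Comp (fun=> 0) f -> Comp (fun=> 0) g -> Sigma0 n (fun x => R (f x) (g x)).
Proof.
move=> HR Hf Hg; have := Sigma0_sub (Comp_pair Hf Hg) HR.
by apply: Sigma0_iff => x; rewrite !npairE.
Qed.

Lemma Sigma0_lt n f g : Comp (fun=> 0) f -> Comp (fun=> 0) g ->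
  Sigma0 n (fun x => f x < g x).
Proof. by move=> Hf Hg; apply: Sigma0_leq => //; comp. Qed.

Ltac sigma := repeat match goal with
  | |- Sigma0 _ (fun x => exists y, @?R x y) => apply: Sigma0_ex
  | |- Sigma0 _ (fun x => _ /\ _) => apply: Sigma0_and
  | |- Sigma0 _ (fun x => _ \/ _) => apply: Sigma0_or
  | |- Sigma0 _ (fun x => forall i, is_true (i < _) -> _) => apply: Sigma0_all; first by comp
  | |- Sigma0 _ (fun x => is_true (_ < _)) => apply: Sigma0_lt; comp
  | |- Sigma0 _ (fun x => is_true (_ <= _)) => apply: Sigma0_leq; comp
  | |- Sigma0 _ (fun x => @eq nat _ _) => apply: Sigma0_eq; comp
  end.

(** * Inductive definitions with Sigma rules *)

(* A witness [w] of a rule instance codes the list of its premises, whose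
   length is [nfst w]. *)
Inductive derivable (rule : nat -> nat -> Prop) : nat -> Prop :=
| Derivable d w : rule d w ->
    (forall i, i < nfst w -> derivable rule (pnth (nsnd w) i)) ->
    derivable rule d.

(** A derivation tree flattened into a list in which the premises of an entry precede it; unlike the
    tree, the list can be coded by numbers. *)
Definition derivation (rule : nat -> nat -> Prop) (s : seq nat) : Prop :=
  forall k, k < size s -> exists w, rule (nth 0 s k) w /\
    forall i, i < nfst w -> exists k', k' < k /\ nth 0 s k' = pnth (nsnd w) i.

Lemma derivation_cat rule s1 s2 :
  derivation rule s1 -> derivation rule s2 -> derivation rule (s1 ++ s2).
Proof.
move=> H1 H2 k; rewrite size_cat nth_cat => ks.
case: ltnP => [lt1|le].
  have [w [Hw Hp]] := H1 _ lt1;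
    exists w; split=> // i /Hp[k' [lt e]]; exists k'; split=> //.
  by rewrite nth_cat ifT // (ltn_trans lt lt1).
have /H2[w [Hw Hp]] : k - size s1 < size s2 by rewrite ltn_subLR //.
exists w; split=> // i /Hp[k' [lt e]]; exists (size s1 + k'); split.
  by rewrite -ltn_subRL.
by rewrite nth_cat ifN ?addKn // -leqNgt leq_addr.
Qed.

Lemma derivableP rule d :
  derivable rule d <-> exists2 s, derivation rule s & d \in s.
Proof.
split=> [|[s Hs /(nthP 0)[k]]]; last first.
  elim/ltn_ind: k d => k IH d ks <-; have [w [Hw Hp]] := Hs _ ks.
  apply: Derivable Hw _ => i /Hp[k' [lt <-]].
  exact: (IH k') (ltn_trans lt ks) _.
elim=> {}d w Hw _ IH.
have [s Hs Hi] : exists2 s, derivation rule s &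
    forall i, i < nfst w -> pnth (nsnd w) i \in s.
  elim: (nfst w) IH => [|b IHb] IH; first by exists [::].
  have [i ib|s Hs Hi] := IHb; first by apply: IH; apply: ltnW.
  have [s' Hs' Hb] := IH b (ltnSn b).
  exists (s ++ s'); first exact: derivation_cat.
  move=> i; rewrite ltnS leq_eqVlt mem_cat => /orP[/eqP->|/Hi->//].
  by rewrite Hb orbT.
exists (rcons s d); last by rewrite mem_rcons inE eqxx.
move=> k; rewrite size_rcons ltnS leq_eqVlt nth_rcons => /orP[/eqP->|ks].
  rewrite ltnn eqxx; exists w; split=> // i /Hi /(nthP 0)[k' lt e].
  by exists k'; rewrite nth_rcons lt.
rewrite ks; have [v [Hv Hp]] := Hs _ ks; exists v; split=> // i /Hp[k' [lt e]].
by exists k'; rewrite nth_rcons (ltn_trans lt ks).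
Qed.

(** A derivation is given by its length [N] and a code [L]; checking it takes only existential and
    bounded universal quantifiers over the rule, which stay within its class. *)
Lemma derivable_Sigma n rule : Sigma0 n.+1 (fun z => rule (nfst z) (nsnd z)) ->
  Sigma0 n.+1 (derivable rule).
Proof.
move=> Hr; apply: (@Sigma0_iff _ (fun d => exists N, exists L,
  (exists k, k < N /\ pnth L k = d) /\
  forall k, k < N -> exists w, rule (pnth L k) w /\
    forall i, i < nfst w -> exists k', k' < k /\ pnth L k' = pnth (nsnd w) i)); last first.
  sigma.
  apply: (Sigma0_sub2 Hr); comp.
move=> d; rewrite derivableP; split=> [[N [L [[k0 [k0N e]] H]]]|[s Hs /(nthP 0)[k0 k0s e]]].
  exists (mkseq (pnth L) N); last by apply/(nthP 0); exists k0; rewrite ?size_mkseq ?nth_mkseq.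
  move=> k; rewrite size_mkseq => kN; have [w [Hw Hp]] := H _ kN.
  exists w; rewrite nth_mkseq //; split=> // i /Hp[k' [lt e']].
  by exists k'; rewrite nth_mkseq // (ltn_trans lt kN).
have [L HL] := pnth_surj (nth 0 s) (size s).
exists (size s), L; split; first by exists k0; rewrite HL.
move=> k ks; have [w [Hw Hp]] := Hs _ ks; exists w; rewrite HL //.
split=> // i /Hp[k' [lt e']].
by exists k'; rewrite HL // (ltn_trans lt ks).
Qed.

Arguments Sigma0 : simpl never.

(** Recursion on the list lets the statement unfold, for an explicit list, into a conjunction of
    equations that [sigma] can treat. *)
Fixpoint agree_from (L j : nat) (s : seq nat) : Prop :=
  if s is a :: s' then pnth L j = a /\ agree_from L j.+1 s' else True.

Definition premises (w : nat) (s : seq nat) : Prop :=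
  nfst w = size s /\ agree_from (nsnd w) 0 s.

Lemma agree_fromP L j s :
  agree_from L j s <-> forall i, i < size s -> pnth L (j + i) = nth 0 s i.
Proof.
elim: s j => [|a s IH] j //=; split=> [[<- /IH H] [|i] lt|H].
- by rewrite addn0.
- by rewrite addnS -addSn H.
split; first by have := H 0; rewrite addn0; apply.
by apply/IH => i lt; rewrite addSn -addnS H.
Qed.

Lemma derivable_premises (rule : nat -> nat -> Prop) d s :
  (forall w, premises w s -> rule d w) ->
  (forall e, e \in s -> derivable rule e) -> derivable rule d.
Proof.
have [L HL] := pnth_surj (nth 0 s) (size s).
have Hw : premises (npair (size s) L) s.
  by rewrite /premises !npairE; split=> //; apply/agree_fromP.
move=> /(_ _ Hw) Hd Hs; apply: Derivable Hd _ => i.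
by case: Hw; rewrite !npairE => _ _ lt; rewrite HL //; apply/Hs/mem_nth.
Qed.

Lemma premises_ind w s (D : nat -> Prop) : premises w s ->
  (forall i, i < nfst w -> D (pnth (nsnd w) i)) -> forall e, e \in s -> D e.
Proof.
case=> -> /agree_fromP H HD e /(nthP 0)[i lt <-].
by rewrite -H //; apply: HD.
Qed.

Lemma Sigma0_True n : Sigma0 n (fun=> True).
Proof. by apply: (@Sigma0_iff _ (fun=> true)) => //; apply: Sigma0_dec; comp. Qed.

Ltac sigma_rule := sigma; rewrite /premises /=; sigma; try exact: Sigma0_True.

(** * Programs and their evaluation as inductive definitions *)

(** Mirrors [encode]: tags below 5 are the leaves, 5 to 7 the binary constructors, 8 is [CMin]. *)
Definition code_rule (e w : nat) : Prop :=
  (exists t, t < 5 /\ e = npair t 0 /\ premises w [::]) \/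
  (exists t a b, 4 < t /\ t < 8 /\ e = npair t (npair a b) /\ premises w [:: a; b]) \/
  (exists a, e = npair 8 a /\ premises w [:: a]).

Definition is_code : set nat := derivable code_rule.

Lemma is_code_Sigma n : Sigma0 n.+1 is_code.
Proof. by apply: derivable_Sigma; rewrite /code_rule; sigma_rule. Qed.

Lemma is_codeP e : is_code e <-> exists c, encode c = e.
Proof.
split=> [|[c <-]].
  elim=> {}e w He _ IH; case: He => [[t [t5 [-> _]]]|[|]].
  - case: t t5 => [|[|[|[|[|]]]]] // _; [exists CZero|exists CSucc|
      exists CFst|exists CSnd|exists COracle] => //.
  - move=> [t [a [b [t4 [t8 [-> Hp]]]]]].
    have IHp := premises_ind (D := fun e => exists c, encode c = e) Hp IH.
    have [|ca ea] := IHp a; first by rewrite mem_head.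
    have [|cb eb] := IHp b; first by rewrite !inE eqxx orbT.
    case: t t4 t8 => [|[|[|[|[|[|[|[|]]]]]]]] // _ _;
      [exists (CPair ca cb)|exists (CComp ca cb)|exists (CRec ca cb)];
      by rewrite /= ea eb.
  - move=> [a [-> Hp]].
    have [|c e1] := premises_ind (D := fun e => exists c, encode c = e) Hp IH (e := a).
      by rewrite mem_head.
    by exists (CMin c); rewrite /= e1.
have leaf t : t < 5 -> is_code (npair t 0).
  move=> t5; apply: (@derivable_premises _ _ [::]) => // w Hw.
  by left; exists t.
have bin t a b : 4 < t < 8 -> is_code a -> is_code b -> is_code (npair t (npair a b)).
  move=> /andP[t4 t8] Ha Hb; apply: (@derivable_premises _ _ [:: a; b]) => [w Hw|e'].
    by right; left; exists t, a, b.
  by rewrite !inE => /orP[]/eqP->.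
elim: c => [|||||c IHc d IHd|c IHc d IHd|c IHc d IHd|c IHc] /=;
  try exact: leaf; try exact: bin.
apply: (@derivable_premises _ _ [:: encode c]) => [w Hw|e'].
  by right; right; exists (encode c).
by rewrite inE => /eqP->.
Qed.

(** The coded judgement that program [e] on input [x] returns [v]. *)
Definition item (e x v : nat) : nat := npair e (npair x v).

(** The number of premises of a [CMin] step depends on its conclusion, so they are not an explicit
    list as in [premises]. *)
Definition min_premises (w a x i : nat) : Prop :=
  nfst w = i.+1 /\ pnth (nsnd w) i = item a (npair x i) 0 /\
  forall j, j < i -> exists r, pnth (nsnd w) j = item a (npair x j) r.+1.

(** The clauses follow those of [eval]. In the base case of [CRec] the step code [b] is not run, so
    no premise certifies it and [is_code b] is demanded instead. *)
Definition eval_rule (h : nat -> nat) (d w : nat) : Prop :=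
  (exists x, premises w [::] /\
     (d = item (npair 0 0) x 0 \/ d = item (npair 1 0) x x.+1 \/
      d = item (npair 2 0) x (nfst x) \/ d = item (npair 3 0) x (nsnd x) \/
      exists v, d = item (npair 4 0) x v /\ h x = v)) \/
  (exists a b x u v, d = item (npair 5 (npair a b)) x (npair u v) /\
     premises w [:: item a x u; item b x v]) \/
  (exists a b x u v, d = item (npair 6 (npair a b)) x v /\
     premises w [:: item b x u; item a u v]) \/
  (exists a b x v, d = item (npair 7 (npair a b)) (npair x 0) v /\
     is_code b /\ premises w [:: item a x v]) \/
  (exists a b x i u v, d = item (npair 7 (npair a b)) (npair x i.+1) v /\
     premises w [:: item (npair 7 (npair a b)) (npair x i) u;
                    item b (npair x (npair i u)) v]) \/
  (exists a x i, d = item (npair 8 a) x i /\ min_premises w a x i).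

Lemma eval_rule_Sigma n h : Sigma0 n.+1 (fun z => h (nfst z) = nsnd z) ->
  Sigma0 n.+1 (fun z => eval_rule h (nfst z) (nsnd z)).
Proof.
move=> Hh; rewrite /eval_rule /min_premises /item; sigma_rule.
  by apply: (Sigma0_sub2 (R := fun x v => h x = v) Hh); comp.
by apply: Sigma0_sub (is_code_Sigma n); comp.
Qed.

Lemma item_inj a x v b y w : item a x v = item b y w -> [/\ a = b, x = y & v = w].
Proof. by move=> /npair_inj[-> /npair_inj[-> ->]]. Qed.

Lemma eval_ruleP h e x v :
  derivable (eval_rule h) (item e x v) <-> kleene_graph h e x v.
Proof.
split=> [|[c <-]].
  move Ed: (item e x v) => d H.
  elim: H e x v Ed => {}d w Hd _ IH e x v Ed.
  have {}IH i a y u : i < nfst w -> pnth (nsnd w) i = item a y u -> kleene_graph h a y u.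
    by move=> lt /esym; apply: IH.
  have IHp s a y u : premises w s -> item a y u \in s -> kleene_graph h a y u.
    move=> Hs Hi; apply: (premises_ind (D := fun e => forall a y u, e = item a y u ->
      kleene_graph h a y u) Hs _ Hi _ _ _ erefl) => i lt b z t; exact: IH.
  case: Hd => [[y [_]]|[|[|[|[|]]]]]; rewrite -{}Ed.
  - case=> [|[|[|[|[u [/item_inj[-> -> ->] <-]]]]]]; try move=> /item_inj[-> -> ->].
    + by exists CZero => //; constructor.
    + by exists CSucc => //; constructor.
    + by exists CFst => //; constructor.
    + by exists CSnd => //; constructor.
    + by exists COracle => //; constructor.
  - move=> [a [b [y [u [t [/item_inj[-> -> ->] Hp]]]]]].
    have [|c <- Hc] := IHp _ a y u Hp; first by rewrite mem_head.
    have [|c' <- Hc'] := IHp _ b y t Hp; first by rewrite !inE eqxx orbT.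
    by exists (CPair c c') => //; apply: eval_pair.
  - move=> [a [b [y [u [t [/item_inj[-> -> ->] Hp]]]]]].
    have [|c <- Hc] := IHp _ b y u Hp; first by rewrite mem_head.
    have [|c' <- Hc'] := IHp _ a u t Hp; first by rewrite !inE eqxx orbT.
    by exists (CComp c' c) => //; apply: eval_comp Hc _.
  - move=> [a [b [y [u [/item_inj[-> -> ->] [/is_codeP[c' <-] Hp]]]]]].
    have [|c <- Hc] := IHp _ a y u Hp; first by rewrite mem_head.
    by exists (CRec c c') => //; apply: eval_rec0.
  - move=> [a [b [y [i [u [t [/item_inj[-> -> ->] Hp]]]]]]].
    have [|c Ec Hc] := IHp _ (npair 7 (npair a b)) (npair y i) u Hp; first by rewrite mem_head.
    have [|c' Ec' Hc'] := IHp _ b (npair y (npair i u)) t Hp; first by rewrite !inE eqxx orbT.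
    (* The tag 7 forces the program of the recursive premise to be a [CRec]; injectivity of [encode]
       then identifies its step code with [c']. *)
    case: c Ec Hc => [|||||c1 c2|c1 c2|c1 c2|c1] /npair_inj[] //.
    move=> _ /npair_inj[<-]; rewrite -Ec' => /encode_inj -> Hc.
    by exists (CRec c1 c') => //; apply: eval_recS Hc Hc'.
  - move=> [a [y [i [/item_inj[-> -> ->] [Hw [H0 Hj]]]]]].
    have [|c Ec Hc] := IH i a (npair y i) 0 _ H0; first by rewrite Hw.
    exists (CMin c); first by rewrite /= Ec.
    have /choice[r Hr] : forall j, exists r, j < i -> eval h c (npair y j) r.+1.
      move=> j; case: (ltnP j i) => [ji|_]; last by exists 0.
      have [r Er] := Hj j ji; exists r => _.
      have [|c' Ec' Hc'] := IH j a (npair y j) r.+1 _ Er; first by rewrite Hw ltnW.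
      by move: Ec'; rewrite -Ec => /encode_inj <-.
    by apply: (eval_min (r := r)).
elim=> {e c x v} [x|x|x|x|x|c d x a b _ IHc _ IHd|c d x a b _ IHd _ IHc|c d x v _ IH
  |c d x i r v _ IHr _ IHv|c x i r _ IHr _ IH0] /=.
- apply: (@derivable_premises _ _ [::]) => // w Hw.
  by left; exists x; split=> //; left.
- apply: (@derivable_premises _ _ [::]) => // w Hw.
  by left; exists x; split=> //; right; left.
- apply: (@derivable_premises _ _ [::]) => // w Hw.
  by left; exists x; split=> //; right; right; left.
- apply: (@derivable_premises _ _ [::]) => // w Hw.
  by left; exists x; split=> //; right; right; right; left.
- apply: (@derivable_premises _ _ [::]) => // w Hw.
  by left; exists x; split=> //; right; right; right; right; exists (h x).
- apply: derivable_premises => [w Hw|f].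
    by right; left; exists (encode c), (encode d), x, a, b; split=> //; apply: Hw.
  by rewrite !inE => /orP[]/eqP->.
- apply: derivable_premises => [w Hw|f].
    by do 2 right; left; exists (encode c), (encode d), x, a, b; split=> //; apply: Hw.
  by rewrite !inE => /orP[]/eqP->.
- apply: derivable_premises => [w Hw|f].
    do 3 right; left; exists (encode c), (encode d), x, v; split=> //; split; last exact: Hw.
    by apply/is_codeP; exists d.
  by rewrite !inE => /eqP->.
- apply: derivable_premises => [w Hw|f].
    do 4 right; left; exists (encode c), (encode d), x, i, r, v; split=> //; apply: Hw.
  by rewrite !inE => /orP[]/eqP->.
(* The premises of a successful search: nonzero values for all [j < i], then the value 0 at [i]. *)
- pose s := rcons (mkseq (fun j => item (encode c) (npair x j) (r j).+1) i)
     (item (encode c) (npair x i) 0).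
  apply: (@derivable_premises _ _ s) => [w [Hw /agree_fromP Hp]|f].
    move: Hw Hp; rewrite size_rcons size_mkseq => Hw Hp.
    do 5 right; exists (encode c), x, i; split=> //; split=> //; split=> [|j ji].
      by have := Hp _ (ltnSn i); rewrite nth_rcons size_mkseq ltnn eqxx.
    exists (r j); have := Hp j; rewrite nth_rcons size_mkseq ji nth_mkseq //.
    by apply; apply: ltnW.
  rewrite mem_rcons inE => /predU1P[->//|/mapP[j]].
  by rewrite mem_iota => /= /IHr H ->.
Qed.

(** * Complexity of the jumps, and selectors *)

Lemma universal_Sigma n h : Sigma0 n.+1 (fun z => h (nfst z) = nsnd z) ->
  Sigma0 n.+1 (fun z => universal h (nfst z) = Some (nsnd z)).
Proof.
move=> /eval_rule_Sigma /derivable_Sigma Hd.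
apply: (@Sigma0_iff _ (fun z => derivable (eval_rule h)
    (npair (nfst (nfst z)) (npair (nsnd (nfst z)) (nsnd z))))).
  by move=> z; rewrite eval_ruleP -kleeneP.
by apply: (Sigma0_sub (f := fun z => npair (nfst (nfst z))
  (npair (nsnd (nfst z)) (nsnd z)))) Hd; comp.
Qed.

(** The value 0 says that a computation in the previous jump halts, the value 1 that it does not: a
    Sigma condition and the complement of one, both in the class one level up. *)
Lemma zero_jump_Sigma n : Sigma0 n.+1 (fun z => zero_jump n (nfst z) = nsnd z).
Proof.
elim: n => [|n IH]; first by apply: (@Sigma0_eq 1 (fun=> 0)); comp.
have Hdom : Sigma0 n.+1 (fun z => exists v, universal (zero_jump n) (nsnd (nfst z)) = Some v).
  apply: Sigma0_ex.
  by apply: (Sigma0_sub2 (R := fun z v => universal (zero_jump n) z = Some v)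
    (universal_Sigma IH)); comp.
apply: (@Sigma0_iff _ (fun z =>
    (exists v, universal (zero_jump n) (nsnd (nfst z)) = Some v) /\ 0 = nsnd z \/
    ~ (exists v, universal (zero_jump n) (nsnd (nfst z)) = Some v) /\ 1 = nsnd z)).
  move=> z /=; rewrite /Gop; case: universal => [v|].
    split=> [[[_ //]|[H]]|<-]; first by case: H; exists v.
    by left; split=> //; exists v.
  split=> [[[[]]|[_]]//|<-]; right; split=> //.
  by case.
apply: Sigma0_or; apply: Sigma0_and; try by apply: Sigma0_eq; comp.
  exact: Sigma0S.
exact: Sigma0_dec_compl.
Qed.

Lemma eval_min_least h c (g : nat -> nat) a i : (forall x, eval h c x (g x)) ->
  eval h (CMin c) a i <->
  g (npair a i) = 0 /\ forall j, j < i -> g (npair a j) <> 0.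
Proof.
move=> Hc; split=> [H|[H0 Hj]].
  inversion H as [| | | | | | | | |? ? ? r Hr H0]; subst.
  split; first exact: eval_fun (Hc _) H0.
  by move=> j /Hr /(eval_fun (Hc _)) ->.
apply: (eval_min (r := fun j => (g (npair a j)).-1)); last by rewrite -H0.
by move=> j /Hj; have := Hc (npair a j); case: (g _).
Qed.

(** One direction of Post's theorem: the next jump decides whether the search for a witness, run in
    the previous one, halts. *)
Lemma Sigma0_zero_jump n (S : set nat) : Sigma0 n S ->
  exists2 p : pred nat, Comp (zero_jump n) (fun x => p x : nat) & forall x, S x <-> p x.
Proof.
elim: n S => [|n IH] S; first by move/decidable_setE.
move=> [P /IH[p [c Hc] HP] HS].
(* The jump is 0 exactly when [CMin c] halts on [x], that is, when [p (npair x y)] is false for some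
   [y]. *)
exists (fun x => zero_jump n.+1 (npair 0 (npair (encode (CMin c)) x)) == 0).
  apply: (Comp_eqn (f := fun x => zero_jump n.+1 _)); last by comp.
  apply: (Comp_oracle (f := fun x => npair _ _)).
  by comp.
move=> x; rewrite HS /= /Gop npairKr.
case E : universal => [v|]; split=> //.
  have [d /encode_inj -> /(eval_min_least _ _ Hc)[H _]] :
      kleene_graph (zero_jump n) (encode (CMin c)) x v.
    by apply/kleeneP; move: E; rewrite /universal !npairE.
  move=> _; exists v => /HP; by rewrite -[p _]lt0b H.
move=> [y Hy]; have Hex : exists y, ~~ p (npair x y).
  by exists y; apply/negP => /HP.
case: (ex_minnP Hex) => i pi mi.
have : kleene (zero_jump n) (encode (CMin c)) x = Some i.
  apply/kleeneP; exists (CMin c) => //; apply/(eval_min_least _ _ Hc); split.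
    by rewrite (negbTE pi).
  move=> j ji pj; have := mi j; rewrite leqNgt ji; case: (p _) pj => // _.
  by move/(_ isT).
by move: E; rewrite /universal !npairE => ->.
Qed.

(** The matrix of [R] is decidable in [zero_jump n], so a program can search for the least code of a
    value together with its witness and return the value. It diverges only if there is none. *)
Lemma Sigma0_selector n (R : nat -> nat -> Prop) :
  Sigma0 n.+1 (fun w => R (nfst w) (nsnd w)) ->
  exists e, forall x, if universal (zero_jump n) (npair e x) is Some v then R x v
    else forall v, ~ R x v.
Proof.
move=> [P /Sigma0_zero_jump[p Hp HP] HR].
have {}HR x v : R x v <-> exists t, ~ P (npair (npair x v) t) by rewrite -HR !npairE.
have [c Hc] : Comp (zero_jump n)
    (fun w => p (npair (npair (nfst w) (nfst (nsnd w))) (nsnd (nsnd w))) : nat).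
  apply: (Comp_comp (f := fun x => p x : nat) (g := fun w => npair _ _)) => //; comp.
exists (encode (CComp CFst (CMin c))) => x.
case E : universal => [v|].
  have [d /encode_inj -> H] : kleene_graph (zero_jump n) (encode (CComp CFst (CMin c))) x v.
    by apply/kleeneP; move: E; rewrite /universal !npairE.
  inversion H as [| | | | | |? ? ? s ? Hm Hf| | |]; subst.
  inversion Hf; subst.
  have [H0 _] := (eval_min_least _ _ Hc).1 Hm.
  by apply/HR; exists (nsnd s) => /HP; move: H0; rewrite !npairE; case: (p _).
move=> v /HR[t Ht].
have Hex : exists s, ~~ p (npair (npair x (nfst s)) (nsnd s)).
  by exists (npair v t); rewrite !npairE; apply/negP => /HP.
case: (ex_minnP Hex) => i pi mi.
have : kleene (zero_jump n) (encode (CComp CFst (CMin c))) x = Some (nfst i).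
  apply/kleeneP; exists (CComp CFst (CMin c)) => //; apply: (eval_comp (a := i)); last by constructor.
  apply/(eval_min_least _ _ Hc); rewrite !npairE; split; first by rewrite (negbTE pi).
  move=> j ji; rewrite !npairE => pj; have := mi j; rewrite leqNgt ji; case: (p _) pj => // _.
  by move/(_ isT).
by move: E; rewrite /universal !npairE => ->.
Qed.

(** * Families and the recursive structure of trees *)

Lemma tree_nested_ind Q (P : tree Q -> Prop) :
  (forall q ts, (forall i T, onth ts i = Some T -> P T) -> P (Node q ts)) ->
  forall T, P T.
Proof.
move=> H; fix IH 1 => -[q ts]; apply: H.
elim: ts => [|T ts IHts] [|i] T' /= e; [discriminate e | discriminate e | |exact: IHts e].
by case: e => <-; apply: IH.
Qed.

Section Families.
Variables (k : option nat) (m n : nat).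
Implicit Types (Y : set nat) (A : nat -> below k).

(** The class of [T] relativized to the level [j] and the domain [Y]; [SigmaN] is the case of level
    0 and the full domain. *)
Definition has_family j i Y (T : Tm k i) A : Prop :=
  exists2 F, is_family j Y T F & determines Y T F A.

Section Subfamilies.
Variables (Q : Type) (q : Q) (ts : seq (tree Q)).
Implicit Types (U : seq nat -> set nat).

Lemma in_tree_child i T tau : onth ts i = Some T ->
  in_tree (Node q ts) (i :: tau) = in_tree T tau.
Proof. by rewrite /in_tree /= => ->. Qed.

Lemma label_child i T tau : onth ts i = Some T ->
  label (Node q ts) (i :: tau) = label T tau.
Proof. by rewrite /label /= => ->. Qed.

Lemma in_tree_cons i tau : in_tree (Node q ts) (i :: tau) ->
  exists2 T, onth ts i = Some T & in_tree T tau.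
Proof. by rewrite /in_tree /=; case: onth => // T; exists T. Qed.

Lemma tilde_child U i T tau : onth ts i = Some T ->
  tilde (Node q ts) U (i :: tau) = tilde T (fun s => U (i :: s)) tau.
Proof.
move=> Ei; apply/seteqP; split=> x [Ux Hx]; split=> // -[sg /= /and3P[sT sp sn] Us]; apply: Hx.
  exists (i :: sg) => //=; rewrite (in_tree_child _ Ei) sT eqxx sp /=.
  by apply: contra sn => /eqP[->].
case: sg sT sp sn Us => [|j sg] // sT /andP[/eqP ij sp] sn Us; subst j.
exists sg => //; apply/and3P; split=> //; first by rewrite -(in_tree_child _ Ei).
by apply: contra sn => /eqP->.
Qed.

(** By monotonicity the sets deeper in the tree lie in those of the children, so removing the latter
    suffices. *)
Lemma tilde_root U :
  (forall tau sg, in_tree (Node q ts) tau -> in_tree (Node q ts) sg ->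
    prefix tau sg -> U sg `<=` U tau) ->
  tilde (Node q ts) U [::] = U [::] `\` [set x | exists i, i < size ts /\ U [:: i] x].
Proof.
move=> HU; apply/seteqP; split=> x [Ux Hx]; split=> //.
  move=> [i [lt Ui]]; apply: Hx; exists [:: i] => //=.
  by rewrite /in_tree /= (onth_lt (Node q ts)).
move=> [[|i sg] //= sT Us].
have {}sT : in_tree (Node q ts) (i :: sg) by case/andP: sT.
apply: Hx; exists i.
have [T Ei _] := in_tree_cons sT.
split; first by rewrite -onthTE Ei.
apply: HU Us => //=; first by rewrite (in_tree_child _ Ei).
by rewrite eqxx prefix0s.
Qed.

End Subfamilies.

Lemma Lset_self Y : Lset n 0 Y Y.
Proof. by exists setT; rewrite ?setIT //; apply: Sigma0_True. Qed.

Lemma Lset_trans Y U V : Lset n 0 Y U -> Lset n 0 U V -> Lset n 0 Y V.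
Proof.
move=> [S HS ->] [S' HS' ->]; exists (S `&` S'); last by rewrite setIA.
exact: Sigma0_and.
Qed.

Lemma Lset_sub Y U : Lset n 0 Y U -> U `<=` Y.
Proof. by move=> [S _ ->] x []. Qed.

(** The same Sigma set [S] cuts [V] out of [U]. This restricts a family on [Y] to the domain of a
    child. *)
Lemma Lset_between Y U V : Lset n 0 Y V -> V `<=` U -> U `<=` Y -> Lset n 0 U V.
Proof.
move=> [S HS ->] VU UY; exists S => //; apply/seteqP; split=> x [H1 H2]; split=> //.
  exact: VU.
exact: UY.
Qed.

(** Turns a definition that speaks of all nodes at once into a recursion on the tree; it is the
    induction step of both inclusions. *)
Lemma has_family_node Y (q : Tm k m) (ts : seq (tree (Tm k m))) A :
  has_family n Y (Node q ts : Tm k m.+1) A <->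
  exists U : nat -> set nat,
    (forall i T, onth ts i = Some T ->
       Lset n 0 Y (U i) /\ has_family n (U i) (T : Tm k m.+1) A) /\
    has_family n.+1 (Y `\` [set x | exists i, i < size ts /\ U i x]) q A.
Proof.
split=> [[[U F] [HL H0 Hm HF] HD]|[U [HU [Fq Hq HDq]]]].
  exists (fun i => U [:: i]); split=> [i T Ei|]; last first.
    rewrite -[in X in X `\` _]H0 -(tilde_root (q := q)) //.
    by exists (F [::]); [apply: HF|apply: HD].
  have iT : in_tree (Node q ts) [:: i] by rewrite (in_tree_child _ _ Ei).
  split; first exact: HL.
  exists (fun s => U (i :: s), fun s => F (i :: s)); [split=> //|].
  - move=> tau; rewrite -(in_tree_child q _ Ei) => tT.
    apply: (@Lset_between Y); [exact: HL| |exact: Lset_sub (HL _ iT)].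
    by apply: Hm; rewrite //= eqxx prefix0s.
  - move=> tau sg; rewrite -!(in_tree_child q _ Ei) => tT sT ts_.
    by apply: Hm => //=; rewrite eqxx.
  - move=> tau r; rewrite -(label_child q _ Ei) -(tilde_child q _ _ Ei).
    exact: HF.
  - move=> tau r; rewrite -(label_child q _ Ei) -(tilde_child q _ _ Ei).
    exact: HD.
have /choice[G HG] : forall i, exists G : Defs.family m.+1, forall T, onth ts i = Some T ->
    is_family n (U i) (T : Tm k m.+1) G /\ determines (U i) (T : Tm k m.+1) G A.
  move=> i; case Ei : (onth ts i) => [T|]; last by exists (fun=> Y, fun=> Fq).
  by have [_ [G H1 H2]] := HU _ _ Ei; exists G => _ [<-].
(* The families of the children are glued under a root that carries [Y] and [Fq]. *)
pose V tau := if tau is i :: s then (G i).1 s else Y.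
pose F tau := if tau is i :: s then (G i).2 s else Fq.
have HGs i T : onth ts i = Some T ->
    is_family n (U i) (T : Tm k m.+1) ((G i).1, (G i).2) /\
    determines (U i) (T : Tm k m.+1) ((G i).1, (G i).2) A.
  by rewrite -surjective_pairing; apply: HG.
have Hmono tau sg : in_tree (Node q ts) tau -> in_tree (Node q ts) sg ->
    prefix tau sg -> V sg `<=` V tau.
  case: tau sg => [|i tau] [|j sg] // Ht Hs /=; first by move=> _ x.
    have [T Ej sT] := in_tree_cons Hs.
    have [[HL _ _ _] _] := HGs _ _ Ej; have [HLU _] := HU _ _ Ej => _.
    exact: Lset_sub (Lset_trans HLU (HL _ sT)).
  case/andP=> /eqP ij; subst j => ts_.
  have [T Ei sT] := in_tree_cons Hs; have [[_ _ Hm _] _] := HGs _ _ Ei.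
  by apply: Hm => //; rewrite -(in_tree_child q _ Ei).
have Eroot : tilde (Node q ts) V [::] = Y `\` [set x | exists i, i < size ts /\ U i x].
  rewrite tilde_root //=; congr (_ `\` _); apply/seteqP.
  split=> x [i [lt Ui]]; exists i; split=> //; move: Ui;
    by have [[_ -> _ _] _] := HGs i _ (onth_lt (Node q ts) lt).
exists (V, F); [split=> //|].
- case=> [|i tau] Ht; first exact: Lset_self.
  have [T Ei tT] := in_tree_cons Ht.
  have [[HL _ _ _] _] := HGs _ _ Ei; have [HLU _] := HU _ _ Ei.
  exact: Lset_trans HLU (HL _ tT).
- case=> [|i tau] r; first by case=> <-; rewrite Eroot.
  case Ei : (onth ts i) => [T|]; last by rewrite /label /= Ei.
  rewrite (label_child _ _ Ei) (tilde_child _ _ _ Ei).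
  by have [[_ _ _ HF] _] := HGs _ _ Ei; apply: HF.
- case=> [|i tau] r; first by case=> <-; rewrite Eroot.
  case Ei : (onth ts i) => [T|]; last by rewrite /label /= Ei.
  rewrite (label_child _ _ Ei) (tilde_child _ _ _ Ei).
  by have [_ HD] := HGs _ _ Ei; apply: HD.
Qed.

End Families.

(** * The numberings [fnm] and the two inclusions *)

Lemma oplus_map S Q (f : S -> nat -> Q) t0 ts v T :
  onth (t0 :: ts) (v %% (size ts).+1) = Some T ->
  oplus (f t0) (map f ts) v = f T (v %/ (size ts).+1).
Proof.
have lt : v %% (size ts).+1 < size (t0 :: ts) by rewrite ltn_mod.
rewrite (onth_lt t0) // => -[<-]; rewrite /oplus -map_cons size_map.
by rewrite (nth_map t0).
Qed.

Lemma fnm_node k m n (q : Tm k m) (t0 : tree (Tm k m)) ts z :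
  @fnm k m.+1 n (Node q (t0 :: ts)) z =
  if universal (zero_jump n) (nsnd z) is Some v
  then oplus (@fnm k m.+1 n t0) (map (@fnm k m.+1 n) ts) v
  else fnm n.+1 q (nfst z).
Proof. by []. Qed.

(** The sets [R i] need not be Sigma uniformly in [i], so the union is built from binary ones
    instead of by a bounded quantifier. *)
Lemma Sigma0_finite_union n p (R : nat -> set nat) :
  (forall i, i < p -> Sigma0 n (R i)) ->
  Sigma0 n (fun x => exists i, i < p /\ R i x).
Proof.
elim: p => [|p IH] HR.
  apply: (@Sigma0_iff _ (fun=> false)); last by apply: Sigma0_dec; comp.
  by move=> x; split=> // -[i []].
have := Sigma0_or (HR p (ltnSn p)) (IH (fun i lt => HR i (ltnW lt))).
apply: Sigma0_iff => x; split=> [[Rp|[i [lt Ri]]]|[i []]].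
- by exists p.
- by exists i; split=> //; apply: ltnW.
rewrite ltnS leq_eqVlt => /orP[/eqP->|lt] Ri; first by left.
by right; exists i.
Qed.

(* The second component of [g x] is the pair of the index [e] of a selector
   and [x] itself: running the selector is left to [cdot], so that [g] needs
   no oracle although the selector uses the n-th jump. *)
Lemma has_family_fnm k m (T : Tm k m) n Y A : has_family n Y T A ->
  exists2 g, Comp (fun=> 0) g & forall x, Y x -> A x = fnm n T (g x).
Proof.
elim: m T n Y A => [|m IHm] T n Y A.
  by case=> F _ HA; exists (fun x => x) => //; comp.
move: T n Y A; apply: tree_nested_ind => q ts IHts n Y A.
move=> /has_family_node[U [HU /IHm[g0 Hg0 HA0]]].
have [ts0|[t0 [ts' Ets]]] : ts = [::] \/ exists t0 ts', ts = t0 :: ts'.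
- by case: (ts) => [|t0 ts']; [left|right; exists t0, ts'].
- exists g0 => // x Yx; rewrite ts0; apply: HA0; split=> // -[i []].
  by rewrite ts0.
set p := size ts; have Ep : p = (size ts').+1 by rewrite /p Ets.
(* [Y] may be any set, so the selector has to work with Sigma sets [S i] that cut the [U i] out of
   [Y]. *)
have /choice[S HS] : forall i, exists S, Sigma0 n.+1 S /\ (i < p -> U i = Y `&` S).
  move=> i; case: (ltnP i p) => [lt|_].
    have [[S HS ->] _] := HU _ _ (onth_lt (Node q ts) lt).
    by exists S; split=> //; rewrite addn0 in HS.
  by exists setT; split=> //; apply: Sigma0_True.
have /choice[G HG] : forall i, exists g, Comp (fun=> 0) g /\
    forall (T : tree (Tm k m)), onth ts i = Some T ->
    forall x, U i x -> A x = @fnm k m.+1 n T (g x).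
  move=> i; case Ei : (onth ts i) => [T|]; last by exists (fun x => x); split=> //; comp.
  have [_ HT] := HU _ _ Ei.
  by have [g Hg HAg] := IHts _ _ Ei _ _ _ HT; exists g; split=> // _ [<-].
(* [G i x * p + i] is the position of the value [G i x] in the summand [i] of the join. *)
have [|e He] := @Sigma0_selector n
    (fun x v => exists i, i < p /\ (S i x /\ v = G i x * p + i)).
  apply: Sigma0_finite_union => i lt; apply: Sigma0_and.
    by apply: Sigma0_sub (HS i).1; comp.
  by have [HGi _] := HG i; apply: Sigma0_eq; comp.
exists (fun x => npair (g0 x) (npair e x)); first by comp.
move=> x Yx; rewrite Ets fnm_node !npairE; move: (He x).
case: universal => [v [i [lt [Si ->]]]|Hn].
  have Ei := onth_lt (Node q ts) lt.
  have Ev : onth (t0 :: ts') ((G i x * p + i) %% (size ts').+1) = Some (nth (Node q ts) ts i).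
    by rewrite -Ets -Ep modnMDl modn_small.
  rewrite (oplus_map _ Ev) -Ep divnMDl ?Ep // -Ep divn_small // addn0.
  by have [_ /(_ _ Ei) HAG] := HG i; apply: HAG; rewrite (HS i).2.
(* Without a value, [x] lies in no [U i], so the root label decides. *)
apply: HA0; split=> // -[i [lt Ui]].
apply: (Hn (G i x * p + i)); exists i; split=> //; split=> //.
by move: Ui; rewrite (HS i).2 // => -[].
Qed.

(* Allowing several values [v] for each [x] avoids searching for one. *)
Lemma fnm_has_family k m (T : Tm k m) n (Y : set nat) A (R : nat -> nat -> Prop) :
  Sigma0 n.+1 (fun z => R (nfst z) (nsnd z)) ->
  (forall x, Y x -> exists v, R x v) ->
  (forall x v, Y x -> R x v -> A x = fnm n T v) -> has_family n Y T A.
Proof.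
elim: m T n Y A R => [|m IHm] T n Y A R.
  move=> _ HY HA; exists Y => // x Yx; have [v Rv] := HY _ Yx.
  exact: HA Rv.
move: T n Y A R; apply: tree_nested_ind => q ts IHts n Y A R HR HY HA.
apply/has_family_node.
case: ts IHts HA => [|t0 ts'] IHts HA.
  exists (fun=> set0); split=> [[]//|]; apply: (IHm _ _ _ _ R); first exact: Sigma0S.
    by move=> x [Yx _]; apply: HY.
  by move=> x v [Yx _]; apply: HA.
set p := (size ts').+1.
(* Some candidate [v] for [x] makes [cdot] halt and evaluate the numbering of child [i] at [a]. *)
pose Ri i x a := exists v, R x v /\ universal (zero_jump n) (nsnd v) = Some (a * p + i).
have HRi i : Sigma0 n.+1 (fun z => Ri i (nfst z) (nsnd z)).
  apply: Sigma0_ex; apply: Sigma0_and; first by apply: (Sigma0_sub2 (R := R) HR); comp.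
  have HU := universal_Sigma (zero_jump_Sigma n).
  by apply: (Sigma0_sub2 (R := fun z v => universal (zero_jump n) z = Some v) HU); comp.
exists (fun i => Y `&` [set x | exists a, Ri i x a]); split=> [i T Ei|].
  split.
    exists [set x | exists a, Ri i x a] => //; rewrite addn0.
    exact: Sigma0_ex.
  apply: (IHts _ _ Ei _ _ _ (Ri i)) => // [x [_ []]//|x a [Yx _] [v [Rv Ev]]].
    by move=> a Ha; exists a.
  have lt : i < p by rewrite -[p]/(size (t0 :: ts')) -onthTE Ei.
  have ET : onth (t0 :: ts') ((a * p + i) %% p) = Some T by rewrite modnMDl modn_small.
  by rewrite (HA _ _ Yx Rv) fnm_node Ev (oplus_map _ ET) divnMDl // divn_small // addn0.
(* On the rest no candidate makes the computation halt, so [cdot] reads the numbering of the root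
   label at [nfst v], one level higher. *)
apply: (IHm _ _ _ _ (fun x a => exists v, R x v /\ a = nfst v)).
- apply/Sigma0S/Sigma0_ex/Sigma0_and; last by apply: Sigma0_eq; comp.
  by apply: (Sigma0_sub2 (R := R) HR); comp.
- by move=> x [/HY[v Rv] _]; exists (nfst v), v.
move=> x a [Yx Hn] [v [Rv ->]]; rewrite (HA _ _ Yx Rv) fnm_node.
(* A value [w] would put [x] into the set of child [w %% p]. *)
case E : universal => [w|] //; case: Hn; exists (w %% p).
split; first by rewrite ltn_mod.
by split=> //; exists (w %/ p), v; rewrite -divn_eq.
Qed.

Theorem theorem5p5 (k : option nat) (hk : two_le k) (T : Tomega k) :
  SigmaN T = [set B | reducible B (fomega T)].
Proof.
apply/seteqP; split=> [A /has_family_fnm[g Hg HA]|A [g /computableE Hg EA]].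
  by exists g; [apply/computableE|apply/funext => x; apply: HA].
(* The relation is the graph of the reducing function, which is decidable. *)
apply: (@fnm_has_family _ _ _ _ _ _ (fun x v => v = g x)).
- by apply: Sigma0_eq; comp.
- by move=> x _; exists (g x).
- by move=> x _ _ ->; rewrite EA.
Qed.
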